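(* Let $X$ be a finite flag complex on $n$ vertices, and let $A$ be a subcomplex of $X$. For $k\ge 1$ (with $X_k\setminus A_k\neq\emptyset$), if $$\lambda_2(G_X)>\frac{1}{k+1}\Big(kn+\max_{\sigma\in X_k\setminus A_k}\big[|\sigma_{k-1}\cap A_{k-1}|+|\{\tau\in X_k\setminus A_k:\tau\cap\sigma\in A_{k-1}\}|\big]\Big),$$ then $H_k(X,A;\mathbb{R})=0$.
   Context: A simplicial complex $X$ is a finite collection of finite sets closed under taking subsets, always containing $\emptyset$; $\dim\sigma=|\sigma|-1$; $X_k$ is the set of $k$-dimensional faces; $V(X)$ is the union of all faces. For $\sigma\in X_k$, $\sigma_{k-1}=\{\tau\in X_{k-1}:\tau\subseteq\sigma\}$. The flag complex of a graph $G$ is the complex on $V(G)$ whose faces are the vertex subsets spanning complete subgraphs of $G$; a flag complex is one of this form. $G_X$ is the $1$-skeleton of $X$ viewed as a graph, and $\lambda_2(G_X)$ is the second smallest eigenvalue (with multiplicity) of its graph Laplacian (degree matrix minus adjacency matrix). $H_k(X,A;\mathbb{R})$ is the usual relative simplicial homology, i.e. the homology of the complex $C_k(X,A;\mathbb{R})=C_k(X;\mathbb{R})/C_k(A;\mathbb{R})$ with the induced boundary maps. *)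

(* Defs.v *)
From HB Require Import structures.
From mathcomp Require Import all_boot all_order all_algebra.
From mathcomp Require Import ring_quotient polyrcf boolp reals.

Set Implicit Arguments.
Unset Strict Implicit.
Unset Printing Implicit Defensive.

Import Order.TTheory GRing.Theory Num.Theory.

Local Open Scope ring_scope.
Local Open Scope quotient_scope.

(* The vertices of a complex or graph are taken in a finite type T, but need
   not exhaust it. *)
Record scomplex (T : finType) := SComplex {
  cplx_faces :> {set {set T}};
  scomplex0 : set0 \in cplx_faces;
  scomplexS : forall s t : {set T}, s \in cplx_faces -> t \subset s -> t \in cplx_faces
}.

Record sgraph (T : finType) := SGraph {
  gverts : {set T};
  adj : rel T;
  adj_sym : symmetric adj;
  adj_irr : irreflexive adj;
  adj_verts : forall u v, adj u v -> u \in gverts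
}.

Section Complexes.
Variable T : finType.
Implicit Types (X A : scomplex T) (G : sgraph T) (s t : {set T}).

Definition verts X : {set T} := \bigcup_(s in cplx_faces X) s.

Definition faces X (k : nat) : {set {set T}} := [set s in cplx_faces X | #|s| == k.+1].

Definition subfaces X s (j : nat) : {set {set T}} := [set t in faces X j | t \subset s].

Definition flag_faces G : {set {set T}} :=
  [set s : {set T} | (s \subset gverts G) &&
     [forall u in s, forall v in s, (u != v) ==> adj G u v]].

Lemma flag_faces0 G : set0 \in flag_faces G.
Proof.
by rewrite inE sub0set; apply/forall_inP => u; rewrite inE.
Qed.

Lemma flag_facesS G s t : s \in flag_faces G -> t \subset s -> t \in flag_faces G.
Proof.
rewrite !inE => /andP[sV /forall_inP cs] ts; rewrite (subset_trans ts sV) /=.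
apply/forall_inP => u ut; apply/forall_inP => v vt.
by have /forall_inP := cs u (subsetP ts _ ut); apply; apply: (subsetP ts).
Qed.

Definition flag_complex G : scomplex T := SComplex (flag_faces0 G) (@flag_facesS G).

Definition is_flag X : Prop :=
  exists G, cplx_faces X = cplx_faces (flag_complex G).

Definition skel_adj X : rel T := fun u v => (u != v) && ([set u; v] \in cplx_faces X).

Lemma skel_adj_sym X : symmetric (skel_adj X).
Proof. by move=> u v; rewrite /skel_adj eq_sym setUC. Qed.

Lemma skel_adj_irr X : irreflexive (skel_adj X).
Proof. by move=> u; rewrite /skel_adj eqxx. Qed.

Lemma skel_adj_verts X u v : skel_adj X u v -> u \in verts X.
Proof. by case/andP=> _ uvX; apply/bigcupP; exists [set u; v]; rewrite ?set21. Qed.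

Definition skeleton1 X : sgraph T :=
  SGraph (@skel_adj_sym X) (@skel_adj_irr X) (@skel_adj_verts X).

End Complexes.

Section Spectrum.
Variable R : realType.

(* The real eigenvalues in nondecreasing order (rootsR is sorted), each repeated
   according to its multiplicity; for symmetric M these are all n eigenvalues. *)
Definition eigenvalues n (M : 'M[R]_n) : seq R :=
  flatten [seq nseq (mup x (char_poly M)) x | x <- rootsR (char_poly M)].

Lemma mem_eigenvalues n (M : 'M[R]_n) x : (x \in eigenvalues M) = eigenvalue M x.
Proof.
have p0 : char_poly M != 0 by rewrite monic_neq0 ?char_poly_monic.
have rE y : (y \in rootsR (char_poly M)) = root (char_poly M) y.
  by have /(_ y) := roots_on_rootsR p0; rewrite in_itv.
rewrite eigenvalue_root_char; apply/flatten_mapP/idP => [[y yr]|rx].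
  by rewrite mem_nseq => /andP[_ /eqP ->]; rewrite -rE.
by exists x; rewrite ?rE // mem_nseq eqxx andbT -XsubC_dvd // dvdp_XsubCl.
Qed.

Variables (T : finType) (G : sgraph T).

Definition degree (v : T) : nat := #|[set w | adj G v w]|.

Definition laplacian : 'M[R]_#|gverts G| :=
  diag_mx (\row_i (degree (enum_val i))%:R)
  - \matrix_(i, j) (adj G (enum_val i) (enum_val j))%:R.

Definition lambda2 : R := (eigenvalues laplacian)`_1.

End Spectrum.

Section Homology.
(* Homology of U -f-> V -g-> W at V: ker g modulo im f \cap ker g, which is
   ker g / im f when g \o f = 0 (for the use below, see rel_boundaryK). *)
Variables (U V W : zmodType) (f : {additive U -> V}) (g : {additive V -> W}).

Definition ker_pred : {pred V} := fun z => g z == 0.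

Lemma ker_closed : zmod_closed ker_pred.
Proof.
split=> [|x y]; rewrite /ker_pred !unfold_in ?raddf0 //.
by move=> /eqP gx /eqP gy; rewrite raddfB gx gy subrr.
Qed.

HB.instance Definition _ := GRing.isZmodClosed.Build V ker_pred ker_closed.

Definition cycles := {z : V | z \in ker_pred}.
HB.instance Definition _ := Choice.on cycles.
HB.instance Definition _ := SubChoice.on cycles.
HB.instance Definition _ := [SubChoice_isSubZmodule of cycles by <:].

Definition im_pred : {pred cycles} := fun z => `[< exists w, f w = val z >].

Lemma im_closed : zmod_closed im_pred.
Proof.
split=> [|x y]; rewrite /im_pred !unfold_in.
  by apply/asboolP; exists 0; rewrite !raddf0.
move=> /asboolP[u fu] /asboolP[v fv]; apply/asboolP.
by exists (u - v); rewrite !raddfB fu fv.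
Qed.

HB.instance Definition _ := GRing.isZmodClosed.Build cycles im_pred im_closed.

Definition homology := Quotient.quot im_pred.
HB.instance Definition _ := GRing.Zmodule.on homology.

End Homology.

Section Chains.
Variables (R : realType) (T : finType).
Implicit Types (X A : scomplex T) (s t : {set T}).

Definition simplex X k := {s : {set T} | s \in faces X k}.
HB.instance Definition _ X k := Finite.on (simplex X k).
HB.instance Definition _ X k := SubFinite.on (simplex X k).

(* k-chains; c s is the coefficient of the simplex s, oriented by the
   enumeration order of T. *)
Definition chain X k := {ffun simplex X k -> R}.
HB.instance Definition _ X k := GRing.Zmodule.on (chain X k).

Definition rank_in s (v : T) : nat := #|[set w in s | (enum_rank w < enum_rank v)%N]|.

(* The linear extension of
     [v_0, ..., v_k] |-> \sum_i (-1)^i [v_0, ..., v_(i-1), v_(i+1), ..., v_k].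
   For k = 0 no s :\ v is a 0-simplex, so this is the zero map. *)
Definition boundary_fun X k (c : chain X k) : chain X k.-1 :=
  [ffun t : simplex X k.-1 => \sum_(s : simplex X k) \sum_(v in val s | val s :\ v == val t)
     (-1) ^+ rank_in (val s) v * c s].

Lemma boundary_additive X k : zmod_morphism (@boundary_fun X k).
Proof.
move=> c d; apply/ffunP => t; rewrite !ffunE -sumrB; apply: eq_bigr => s _.
by rewrite -sumrB; apply: eq_bigr => v _; rewrite !ffunE mulrBr.
Qed.

HB.instance Definition _ X k :=
  GRing.isZmodMorphism.Build (chain X k) (chain X k.-1) (@boundary_fun X k)
    (@boundary_additive X k).

Lemma rank_inD1 s v w : w \in s ->
  rank_in s v = ((enum_rank w < enum_rank v) + rank_in (s :\ w) v)%N.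
Proof.
move=> ws; rewrite /rank_in (cardsD1 w) !inE ws /=; congr (_ + _)%N.
by apply: eq_card => x; rewrite !inE andbA.
Qed.

Lemma rank_swap s v w : v \in s -> w \in s -> v != w ->
  (-1) ^+ rank_in s w * (-1) ^+ rank_in (s :\ w) v
  = - ((-1) ^+ rank_in s v * (-1) ^+ rank_in (s :\ v) w) :> R.
Proof.
move=> vs ws nvw; rewrite (rank_inD1 w vs) (rank_inD1 v ws) !exprD.
have : enum_rank v != enum_rank w by rewrite (inj_eq enum_rank_inj).
by rewrite -val_eqE neq_ltn /=; case: ltngtP => // _ _; rewrite !expr1 !expr0;
  rewrite ?mul1r ?mulN1r ?mulNr ?opprK mulrC.
Qed.

Lemma boundaryK X k (c : chain X k) : boundary_fun (boundary_fun c) = 0.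
Proof.
case: k c => [|k] c; apply/ffunP => u; rewrite ![in LHS]ffunE [RHS]ffunE.
  apply: big1 => t _; apply: big1 => v /andP[vt /eqP tu]; exfalso.
  move: (valP u) (valP t); rewrite -tu !inE /= => /andP[_ /eqP c1] /andP[_ /eqP c2].
  by move: (cardsD1 v (val t)); rewrite vt c2 c1.
pose F (s : simplex X k.+1) w v : R :=
  if [&& w \in val s, v \in val s :\ w & (val s :\ w) :\ v == val u]
  then (-1) ^+ rank_in (val s) w * (-1) ^+ rank_in (val s :\ w) v else 0.
transitivity (\sum_(s : simplex X k.+1) (\sum_w \sum_v F s w v) * c s).
  under eq_bigr => t _.
    rewrite (eq_bigr (fun v => \sum_(s : simplex X k.+1)
      \sum_(w in val s | val s :\ w == val t)
        ((-1) ^+ rank_in (val s) w * (-1) ^+ rank_in (val t) v) * c s)); last first.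
      move=> v _; rewrite ffunE mulr_sumr; apply: eq_bigr => s _.
      by rewrite mulr_sumr; apply: eq_bigr => w _; rewrite mulrA [X in X * _]mulrC.
    rewrite exchange_big /=; over.
  rewrite exchange_big /=; apply: eq_bigr => s _.
  under eq_bigr => t _ do rewrite exchange_big /= big_mkcondr /=.
  rewrite exchange_big /= mulr_suml big_mkcond /=; apply: eq_bigr => w _.
  case: ifP => ws; last by rewrite big1 ?mul0r // => v _; rewrite /F ws.
  have tX : val s :\ w \in faces X k.
    move: (valP s); rewrite !inE => /andP[sX /eqP cs].
    rewrite (scomplexS sX) ?subsetDl //=.
    by move: (cardsD1 w (val s)); rewrite ws cs add1n => -[cw]; apply/eqP; exact: esym cw.
  rewrite (bigD1 (exist (fun t : {set T} => t \in faces X k) _ tX : simplex X k)) //=.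
  rewrite [X in _ + X]big1 ?addr0; last first.
    move=> t nt; case: ifP => // /eqP st; case/eqP: nt; apply: val_inj.
    by rewrite /= -st.
  rewrite eqxx.
  rewrite mulr_suml big_mkcond /=; apply: eq_bigr => v _.
  by rewrite /F ws /=; case: ifP; rewrite ?mul0r.
apply: big1 => s _; suff -> : \sum_w \sum_v F s w v = 0 by rewrite mul0r.
have FN w v : F s w v = - F s v w.
  rewrite /F !inE; have [->|nvw] := eqVneq v w; first by rewrite !andbF oppr0.
  rewrite /= setDDl setUC -setDDl.
  case ws: (w \in val s); case vs: (v \in val s) => /=; rewrite ?oppr0 //.
  by case: ifP; rewrite ?oppr0 // => _; apply: rank_swap.
have E : \sum_w \sum_v F s w v = - \sum_w \sum_v F s w v.
  rewrite [in LHS]exchange_big /= -sumrN; apply: eq_bigr => v _.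
  by rewrite -sumrN; apply: eq_bigr => w _.
by apply/eqP; rewrite -[_ == 0](mulrn_eq0 _ 2) mulr2n {1}E addNr.
Qed.

(* C_k(A) as a subgroup of C_k(X): the chains supported on A. *)
Definition subchain X A k : {pred chain X k} :=
  fun c => [forall s : simplex X k, (val s \notin faces A k) ==> (c s == 0)].
Arguments subchain : clear implicits.

Lemma subchainP X A k (c : chain X k) :
  reflect (forall s : simplex X k, val s \notin faces A k -> c s = 0) (c \in subchain X A k).
Proof.
apply: (iffP forallP) => h s; last by apply/implyP => sA; rewrite h.
by move=> sA; apply/eqP/(implyP (h s)).
Qed.

Lemma subchain_closed X A k : zmod_closed (subchain X A k).
Proof.
split=> [|c d /subchainP hc /subchainP hd]; apply/subchainP => s sA.
  by rewrite ffunE.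
by rewrite !ffunE hc // hd // subrr.
Qed.

HB.instance Definition _ X A k :=
  GRing.isZmodClosed.Build (chain X k) (subchain X A k) (@subchain_closed X A k).

Lemma boundary_subchain X A k (c : chain X k) :
  c \in subchain X A k -> boundary_fun c \in subchain X A k.-1.
Proof.
move=> /subchainP hc; apply/subchainP => t tA; rewrite ffunE big1 // => s _.
rewrite big1 // => v /andP[vs /eqP st].
have [sA|/hc ->] := boolP (val s \in faces A k); last by rewrite mulr0.
case/negP: tA; move: sA (valP t); rewrite !inE => /andP[sA _] /andP[_ ->].
by rewrite andbT -st; apply: (scomplexS sA); apply: subsetDl.
Qed.

(* C_k(X) / C_k(A) *)
Definition rel_chain X A k := Quotient.quot (subchain X A k).
HB.instance Definition _ X A k := GRing.Zmodule.on (rel_chain X A k).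
HB.instance Definition _ X A k := Choice.on (rel_chain X A k).
HB.instance Definition _ X A k := EqQuotient.on (rel_chain X A k).
HB.instance Definition _ X A k := ZmodQuotient.on (rel_chain X A k).

Definition rel_boundary_fun X A k (x : rel_chain X A k) : rel_chain X A k.-1 :=
  \pi_(rel_chain X A k.-1) (boundary_fun (repr x)).

Lemma rel_boundary_pi X A k (c : chain X k) :
  rel_boundary_fun (\pi_(rel_chain X A k) c) = \pi_(rel_chain X A k.-1) (boundary_fun c).
Proof.
apply/eqP; rewrite -Quotient.idealrBE -raddfB; apply: boundary_subchain.
by rewrite Quotient.idealrBE reprK.
Qed.

Lemma rel_boundary_additive X A k : zmod_morphism (@rel_boundary_fun X A k).
Proof.
move=> x y; rewrite -[x]reprK -[y]reprK -raddfB !rel_boundary_pi.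
by rewrite !raddfB.
Qed.

HB.instance Definition _ X A k :=
  GRing.isZmodMorphism.Build (rel_chain X A k) (rel_chain X A k.-1)
    (@rel_boundary_fun X A k) (@rel_boundary_additive X A k).

Definition rel_boundary X A k : {additive rel_chain X A k -> rel_chain X A k.-1} :=
  @rel_boundary_fun X A k.

Lemma rel_boundaryK X A k (x : rel_chain X A k) : rel_boundary X A k.-1 (rel_boundary X A k x) = 0.
Proof.
by rewrite -[x]reprK /= !rel_boundary_pi boundaryK raddf0.
Qed.

(* H_k(X, A; R), as an additive group. *)
Definition rel_homology X A k :=
  homology (rel_boundary X A k.+1) (rel_boundary X A k).
HB.instance Definition _ X A k := GRing.Zmodule.on (rel_homology X A k).

Lemma rel_homology_eq0P X A k : (forall h : rel_homology X A k, h = 0) <->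
  (forall c : chain X k, boundary_fun c \in subchain X A k.-1 ->
    exists d : chain X k.+1, c - boundary_fun d \in subchain X A k).
Proof.
split=> [H c dc|H h].
  have z : \pi_(rel_chain X A k) c \in ker_pred (rel_boundary X A k).
    rewrite unfold_in /ker_pred /= rel_boundary_pi -(raddf0 (\pi_(rel_chain X A k.-1))).
    by rewrite -Quotient.idealrBE subr0.
  have := H (\pi_(rel_homology X A k) (exist (fun z => z \in ker_pred (rel_boundary X A k)) _ z)).
  rewrite -(raddf0 (\pi_(rel_homology X A k))) => /eqP.
  rewrite -Quotient.idealrBE subr0 unfold_in => /asboolP [w]; rewrite -[w]reprK /= rel_boundary_pi.
  move=> /esym/eqP; rewrite -Quotient.idealrBE => ?; by exists (repr w).
rewrite -[h]reprK; move: (repr h) => [z zk].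
rewrite -[0](raddf0 (\pi_(rel_homology X A k))); apply/eqP.
rewrite -Quotient.idealrBE subr0 unfold_in; apply/asboolP => /=.
move: (zk); rewrite unfold_in /ker_pred /= -[z]reprK rel_boundary_pi.
rewrite -[0](raddf0 (\pi_(rel_chain X A k.-1))) -Quotient.idealrBE subr0 => /H[d hd].
exists (\pi d); rewrite rel_boundary_pi; apply/esym/eqP.
by rewrite -Quotient.idealrBE.
Qed.

End Chains.
Arguments subchain R {T} X A k _.

(* Main.v *)
Require Import Defs.
From mathcomp Require Import all_boot all_order all_algebra.
From mathcomp Require Import complex polyrcf reals ring lra.

(** Over the reals a chain complex is exact in degree k as soon as its Laplacian has no kernel
    there, that is, as soon as the only relative k-chain f with zero coboundary and zero
    relative boundary is f = 0 ([exact_of_no_harmonic]).  So let f be such a chain, extended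
    by zero to all k-faces of X.

    The Laplacian of X itself is controlled by the graph ([flag_hodge_form], after Aharoni,
    Berger and Meshulam).  For each (k-1)-face t, the signed values f (v |: t) form a function
    on the vertices, to which the spectral gap of the graph Laplacian applies.  Summing over
    t, the mixed products f (v |: t) * f (w |: t) with v, w adjacent are exactly those in the
    expansion of the squared norm of the coboundary of f, because in a flag complex adjacency
    of v and w already makes t, v, w a face.  The remaining diagonal terms are counted, and
    one finds
      (k + 1) * lambda2 * |f|^2 <= k * n * |f|^2 + |coboundary f|^2 + |boundary f|^2,
    with n the number of vertices.

    Here the coboundary of f is zero, and its boundary is zero outside A.  The part of the
    boundary on the (k-1)-faces of A is bounded by Cauchy-Schwarz: its squared norm is at most
    |f|^2 times the maximum, over the relative k-faces s, of the number of pairs (t, x) where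
    t is a facet of s in A and x is a relative k-face containing t.  The pairs with x = s
    account for the facets of s in A, the others for the x whose intersection with s is in A
    ([sum_bd_sqr_le]).  The hypothesis on lambda2 then forces |f|^2 = 0.

    The spectral gap itself ([lambda2_form]) comes from the spectral theorem for Hermitian
    matrices. *)

Set Implicit Arguments.
Unset Strict Implicit.
Unset Printing Implicit Defensive.

Import Order.TTheory GRing.Theory Num.Theory.

Local Open Scope ring_scope.
Local Open Scope sesquilinear_scope.

Local Notation cmx := (map_mx (real_complex _)).

(** * Spectrum of a real symmetric matrix *)

Lemma char_poly_conj (F : fieldType) n (P A : 'M[F]_n) :
  P \in unitmx -> char_poly (invmx P *m A *m P) = char_poly A.
Proof.
move=> Pu; rewrite /char_poly.
have PPu : map_mx polyC P \in unitmx.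
  by rewrite unitmxE det_map_mx rmorph_unit // -unitmxE.
suff -> : char_poly_mx (invmx P *m A *m P) =
    invmx (map_mx polyC P) *m char_poly_mx A *m map_mx polyC P.
  by rewrite !det_mulmx mulrAC -det_mulmx mulVmx ?det1 ?mul1r.
rewrite /char_poly_mx mulmxBr mulmxBl !map_mxM /=; congr (_ - _); last first.
  by congr (_ *m _ *m _); rewrite map_invmx.
by rewrite mul_mx_scalar -scalemxAl mulVmx // scalemx1.
Qed.

(** The spectral theorem for Hermitian matrices, applied over the complex numbers: the
    diagonal entries are real, so the characteristic polynomial already splits over
    the real field, although the diagonalizing matrix is only known to be complex. *)
Lemma real_sym_diagonalization (R : rcfType) n (M : 'M[R]_n) : M^T = M ->
  exists (d : 'rV[R]_n) (U : 'M[R[i]]_n),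
   [/\ char_poly M = \prod_(x <- [seq d 0 i | i <- enum 'I_n]) ('X - x%:P),
       U \is unitarymx &
       cmx M = U^t* *m diag_mx (cmx d) *m U].
Proof.
move=> symM; set MC := map_mx _ M.
have MCh : MC \is hermsymmx.
  apply: realsym_hermsym.
    by apply/is_hermitianmxP; rewrite expr0 scale1r map_mx_id // map_trmx symM.
  by apply/mxOverP => i j; rewrite mxE; apply/complex_realP; exists (M i j).
have dr := hermitian_spectral_diag_real MCh.
have /hermitian_normalmx/orthomx_spectralP MCE := MCh.
pose d := map_mx (@complex.Re R) (spectral_diag MC).
have dE : cmx d = spectral_diag MC.
  by apply/rowP => i; rewrite !mxE RRe_real //; apply: (mxOverP dr).
exists d, (spectralmx MC); split; last 2 first.
- exact: spectral_unitarymx.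
- by rewrite dE -invmx_unitary ?spectral_unitarymx.
apply: (map_poly_inj (real_complex R)); rewrite map_char_poly.
rewrite -/MC {1}MCE char_poly_conj ?spectral_unit // char_poly_trig ?diag_mx_is_trig //.
rewrite rmorph_prod big_map big_enum /=; apply: eq_bigr => i _.
by rewrite map_polyXsubC -dE !mxE eqxx mulr1n.
Qed.

Lemma count_mem_eigenvalues (R : realType) n (M : 'M[R]_n) x :
  count_mem x (eigenvalues M) = mup x (char_poly M).
Proof.
have p0 : char_poly M != 0 by rewrite monic_neq0 ?char_poly_monic.
have rE : (x \in rootsR (char_poly M)) = root (char_poly M) x.
  by have /(_ x) := roots_on_rootsR p0; rewrite in_itv.
have u : uniq (rootsR (char_poly M)) by apply: uniq_roots.
rewrite count_flatten -map_comp /= sumnE big_map /=.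
have [rx|nrx] := boolP (x \in rootsR (char_poly M)).
  rewrite (bigD1_seq x) //= count_nseq /= eqxx mul1n big1 ?addn0 // => y /negbTE yx.
  by rewrite count_nseq /= yx.
rewrite big_seq big1 ?mupNroot -?rE // => y yr.
rewrite count_nseq /=; case: eqP => // yx; by rewrite -yx yr in nrx.
Qed.

Lemma sorted_eigenvalues (R : realType) n (M : 'M[R]_n) :
  sorted <=%R (eigenvalues M).
Proof.
rewrite /eigenvalues; set p := char_poly M.
have := sorted_roots (- cauchy_bound p) (cauchy_bound p) p.
rewrite -/(rootsR _); elim: (rootsR _) => //= x s IH xs.
rewrite sorted_pairwise; last exact: le_trans.
rewrite pairwise_cat -!sorted_pairwise; try exact: le_trans.
rewrite IH ?(path_sorted xs) // andbT; apply/andP; split.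
  apply/allrelP => y z /nseqP[-> _] /flatten_mapP[t ts /nseqP[-> _]].
  apply: ltW; move: xs; rewrite path_sortedE; last exact: lt_trans.
  by case/andP => /allP/(_ _ ts).
by elim: (mup _ _) => //= -[|m] //= ->; rewrite lexx.
Qed.

Lemma eigenvalues_perm (R : realType) n (M : 'M[R]_n) s :
  char_poly M = \prod_(x <- s) ('X - x%:P) -> perm_eq (eigenvalues M) s.
Proof.
move=> Ms; apply/allP => x _ /=.
by rewrite count_mem_eigenvalues Ms mu_prod_XsubC.
Qed.

(** The Courant-Fischer bound in the case where the first eigenvector is known.
    In a unitary eigenbasis, e only has coordinates along the null eigenvalues.  Two
    eigenvalues below the second one would contradict its rank in the sorted list, and
    it is positive, so there is just one null eigenvalue, whose coordinate vanishes
    on every v orthogonal to e. *)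
Lemma quadratic_form_ge_second_eigenvalue (R : realType) n (M : 'M[R]_n) (e v : 'rV[R]_n) :
  M^T = M -> e != 0 -> e *m M = 0 -> 0 < (eigenvalues M)`_1 ->
  (e *m v^T) 0 0 = 0 ->
  (eigenvalues M)`_1 * (v *m v^T) 0 0 <= (v *m M *m v^T) 0 0.
Proof.
move=> symM e0 eM l0 ev; set l := _`_1.
have [d [U [Md UU ME]]] := real_sym_diagonalization symM.
pose w (u : 'rV[R]_n) := cmx u *m U^t*.
have CT p q (B : 'M[R]_(p, q)) : (cmx B)^t* = (cmx B)^T.
  apply/matrixP => i j; rewrite !mxE; apply: conjc_real.
(* Parseval, and the same expansion for the quadratic form. *)
have dotE (u1 u2 : 'rV[R]_n) : ((u1 *m u2^T) 0 0)%:C%C = \sum_i w u1 0 i * (w u2 0 i)^*.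
  transitivity ((w u1 *m (w u2)^t*) 0 0).
    rewrite /w trmx_mul map_mxM /= trmxCK CT mulmxA mulmxKtV //.
    by rewrite map_trmx -map_mxM [RHS]mxE.
  by rewrite mxE; apply: eq_bigr => i _; rewrite !mxE.
have formE : ((v *m M *m v^T) 0 0)%:C%C = \sum_i (d 0 i)%:C%C * (w v 0 i * (w v 0 i)^*).
  transitivity ((w v *m diag_mx (cmx d) *m (w v)^t*) 0 0).
    rewrite /w trmx_mul map_mxM /= trmxCK CT mulmxA -(mulmxA _ (_^t*)) -(mulmxA (cmx v)).
    by rewrite -ME map_trmx -!map_mxM [RHS]mxE.
  rewrite mxE; apply: eq_bigr => i _; rewrite mul_mx_diag !mxE.
  by rewrite mulrCA mulrA.
have wed i : w e 0 i * (d 0 i)%:C%C = 0.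
  have : w e *m diag_mx (cmx d) = 0.
    have : w e *m diag_mx (cmx d) *m U = 0.
      by rewrite /w -!mulmxA [_ *m (_ *m U)]mulmxA -ME -map_mxM eM map_mx0.
    by move/(congr1 (mulmx^~ (U^t*))); rewrite mul0mx mulmxtVK.
  by move/rowP/(_ i); rewrite mul_mx_diag !mxE.
have we0 : exists i, w e 0 i != 0.
  apply/existsP; apply: contraNT e0; rewrite negb_exists => /forallP we0.
  have : w e = 0 by apply/rowP => i; rewrite [RHS]mxE; apply/eqP; rewrite -[_ == _]negbK.
  move/(congr1 (mulmx^~ U)); rewrite mul0mx mulmxKtV // => /rowP Ce.
  apply/eqP/rowP => i; have := Ce i; rewrite !mxE; exact: complexI.
case: we0 => i0 wei0.
have di0 : d 0 i0 = 0.
  by have /eqP := wed i0; rewrite mulf_eq0 (negbTE wei0) /= => /eqP/complexI.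
(* Otherwise d 0 i and d 0 i0 = 0 would be two eigenvalues below the second one. *)
have dl i : i != i0 -> l <= d 0 i.
  move=> ii0; rewrite leNgt; apply/negP => dil.
  have /permP cnt := eigenvalues_perm Md.
  pose below : pred R := fun x => x < l.
  have := cnt below; rewrite count_map.
  suff [c1 c2] : (count below (eigenvalues M) <= 1)%N /\
     (2 <= count (preim [eta d 0%R] below) (enum 'I_n))%N.
    by move=> E; move: c2; rewrite -E leqNgt ltnS c1.
  split.
    have := sorted_eigenvalues M; rewrite /below /l.
    case: (eigenvalues M) => [|a [|b s]] //=; first by rewrite addn0 leq_b1.
    rewrite ltxx add0n => /andP[_]; rewrite path_sortedE; last exact: le_trans.
    case/andP => /allP bs _; rewrite (eq_in_count (a2 := pred0)) ?count_pred0 ?addn0.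
      by rewrite leq_b1.
    by move=> x /bs bx /=; apply/negbTE; rewrite -leNgt.
  rewrite -size_filter -(card_uniqP _); last by rewrite filter_uniq ?enum_uniq.
  apply: leq_trans (_ : #|[set i; i0]| <= _)%N; first by rewrite cards2 ii0.
  apply/subset_leq_card/subsetP => j; rewrite !inE mem_filter mem_enum /= andbT.
  by case/orP => /eqP ->; rewrite // di0.
have wei i : i != i0 -> w e 0 i = 0.
  move=> /dl ld; have /eqP := wed i; rewrite mulf_eq0 => /orP[/eqP // | /eqP /complexI di].
  by move: (lt_le_trans l0 ld); rewrite di ltxx.
have wvi0 : w v 0 i0 = 0.
  have := dotE e v; rewrite ev (bigD1 i0) //= big1 ?addr0; last first.
    by move=> i /wei ->; rewrite mul0r.
  move/esym/eqP; rewrite mulf_eq0 (negbTE wei0) conjC_eq0 /= => /eqP; exact.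
rewrite -lecR rmorphM /= dotE formE mulr_sumr; apply: ler_sum => i _.
have [->|/dl ld] := eqVneq i i0; first by rewrite wvi0 mul0r !mulr0.
by rewrite ler_wpM2r ?mul_conjC_ge0 // lecR.
Qed.

(** * The graph Laplacian *)

Section Graph.
Variables (R : realType) (T : finType) (G : sgraph T).
Local Notation V := (gverts G).
Local Notation L := (laplacian R G).
Local Notation one := (const_mx 1 : 'rV[R]_#|V|).

Lemma degreeE v : (degree G v)%:R = \sum_(w in V) (adj G v w)%:R :> R.
Proof.
rewrite -natr_sum /degree -sum1_card; congr (_%:R).
rewrite [RHS](bigID (adj G v)) /= [X in (_ + X)%N]big1 ?addn0; last first.
  by move=> w /andP[_ /negbTE ->].
apply: eq_big => [w|w]; rewrite inE; last by move=> ->.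
have [vw|_] := boolP (adj G v w); last by rewrite andbF.
by rewrite adj_sym in vw; rewrite (adj_verts vw).
Qed.

Lemma laplacian_sym : L^T = L.
Proof.
apply/matrixP => i j; rewrite !mxE adj_sym; congr (_ - _).
by have [->|nij] := eqVneq i j; rewrite ?eqxx // eq_sym (negbTE nij).
Qed.

Lemma ones_laplacian : one *m L = 0.
Proof.
apply/rowP => j; rewrite [RHS]mxE /laplacian mulmxBr [LHS]mxE mul_mx_diag !mxE mul1r.
rewrite degreeE big_enum_val /= -sumrB big1 // => i _.
by rewrite !mxE mul1r adj_sym subrr.
Qed.

Lemma laplacian_form (g : T -> R) (v := \row_i g (enum_val i)) :
  (v *m L *m v^T) 0 0 = \sum_(u in V) (degree G u)%:R * g u ^+ 2
     - \sum_(u in V) \sum_(w in V | adj G u w) g u * g w.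
Proof.
rewrite /laplacian mulmxBr mulmxBl [LHS]mxE [X in _ + X = _]mxE mul_mx_diag; congr (_ - _).
  rewrite big_enum_val mxE; apply: eq_bigr => i _; rewrite !mxE expr2; ring.
rewrite mxE [RHS]big_enum_val.
apply: eq_bigr => j _; rewrite !mxE mulr_suml big_mkcondr [RHS]big_enum_val.
apply: eq_bigr => i _; rewrite !mxE adj_sym; case: (adj G _ _) => /=; ring.
Qed.

Lemma dot_row (f g : T -> R) :
  ((\row_(i < #|V|) f (enum_val i)) *m (\row_(i < #|V|) g (enum_val i))^T) 0 0 =
  \sum_(u in V) f u * g u.
Proof. by rewrite mxE [RHS]big_enum_val; apply: eq_bigr => i _; rewrite !mxE. Qed.

(** The quadratic form of the Laplacian is invariant under adding a constant to g, so the
    bound on the orthogonal complement of the constants applies to g minus its mean; the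
    subtracted term is the squared norm of the constant part of g. *)
Lemma lambda2_form_centered (g : T -> R) : (1 < #|V|)%N -> 0 < lambda2 R G ->
  lambda2 R G * (\sum_(u in V) g u ^+ 2 - (\sum_(u in V) g u) ^+ 2 / #|V|%:R)
  <= \sum_(u in V) (degree G u)%:R * g u ^+ 2
     - \sum_(u in V) \sum_(w in V | adj G u w) g u * g w.
Proof.
move=> V1 l0; set s := \sum_(u in V) g u.
have V0 : #|V|%:R != 0 :> R by rewrite pnatr_eq0 -lt0n ltnW.
pose v : 'rV[R]_#|V| := \row_i g (enum_val i).
pose w := v - (s / #|V|%:R) *: one.
have oneE : one = \row_(i < #|V|) (fun _ => 1) (enum_val i) by apply/rowP => i; rewrite !mxE.
have vone : (v *m one^T) 0 0 = s.
  by rewrite oneE [LHS](dot_row g (fun=> 1)); apply: eq_bigr => u _; rewrite mulr1.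
have onev : (one *m v^T) 0 0 = s.
  by rewrite oneE [LHS](dot_row (fun=> 1) g); apply: eq_bigr => u _; rewrite mul1r.
have oneone : (one *m one^T) 0 0 = #|V|%:R.
  by rewrite oneE [LHS](dot_row (fun=> 1) (fun=> 1)) mulr1 sumr_const.
have := @quadratic_form_ge_second_eigenvalue R _ L one w laplacian_sym _ ones_laplacian l0.
have wE : w^T = v^T - (s / #|V|%:R) *: one^T by rewrite linearB linearZ.
have E1 (x z : 'M[R]_1) (b : R) : (x - b *: z) 0 0 = x 0 0 - b * z 0 0.
  by rewrite !mxE.
rewrite -/(lambda2 R G) wE mulmxBr -scalemxAr E1 onev oneone divfK //.
have Lone : L *m one^T = 0.
  by rewrite -[LHS]trmxK trmx_mul trmxK laplacian_sym ones_laplacian trmx0.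
have -> : w *m L = v *m L by rewrite mulmxBl -scalemxAl ones_laplacian scaler0 subr0.
rewrite [v *m L *m (_ - _)]mulmxBr -scalemxAr -(mulmxA v L one^T) Lone mulmx0 scaler0 subr0.
rewrite laplacian_form.
rewrite subrr => /(_ _ erefl); rewrite mulmxBl -scalemxAl.
have -> : v *m (v^T - (s / #|V|%:R) *: one^T)
   - (s / #|V|%:R) *: (one *m (v^T - (s / #|V|%:R) *: one^T))
   = v *m v^T - (s / #|V|%:R) *: (v *m one^T) - (s / #|V|%:R) *: (one *m v^T)
     + (s / #|V|%:R) ^+ 2 *: (one *m one^T).
  rewrite !mulmxBr -!scalemxAr scalerBr scalerA expr2 opprB !addrA.
  by rewrite addrAC.
move=> H; apply: le_trans (H _); last first.
  apply/eqP => /rowP/(_ (Ordinal (ltnW V1)))/eqP; rewrite !mxE oner_eq0 //.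
rewrite le_eqVlt; apply/predU1P; left; congr (_ * _).
have E (x y z : 'M[R]_1) (a b c : R) : (x - a *: y - b *: z) 0 0 = x 0 0 - a * y 0 0 - b * z 0 0.
  by rewrite !mxE.
have E' (x z : 'M[R]_1) (b : R) : (x + b *: z) 0 0 = x 0 0 + b * z 0 0.
  by rewrite !mxE.
rewrite E' E // vone onev oneone (dot_row g g) -/s.
under [X in _ = X - _ - _ + _]eq_bigr do rewrite -expr2.
by field.
Qed.

Lemma degree_lt (u : T) : u \in V -> (degree G u < #|V|)%N.
Proof.
move=> uV; apply: proper_card; apply/properP; split.
  by apply/subsetP => w; rewrite inE adj_sym; apply: adj_verts.
by exists u; rewrite // inE adj_irr.
Qed.

(** Tested on the indicator of a vertex u, the previous inequality reads
    lambda2 * (1 - 1 / n) <= degree u, and degree u <= n - 1. *)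
Lemma lambda2_le_order : (1 < #|V|)%N -> 0 < lambda2 R G -> lambda2 R G <= #|V|%:R.
Proof.
move=> V1 l0; have /card_gt0P[u uV] : (0 < #|V|)%N by apply: ltnW.
have := @lambda2_form_centered (fun w => (w == u)%:R) V1 l0.
have only (F : T -> R) : (forall w, w != u -> F w = 0) -> \sum_(w in V) F w = F u.
  by move=> F0; rewrite (bigD1 u) //= big1 ?addr0 // => w /andP[_ /F0].
rewrite !only; try by move=> w /negbTE ->; rewrite ?expr0n ?mulr0.
  rewrite eqxx big1 => [|w /andP[_ uw]]; last first.
    by case: eqP uw => [->|]; rewrite ?adj_irr // mulr0.
  rewrite !expr1n subr0 mulr1 => H.
  have dn : (degree G u)%:R <= #|V|%:R - 1 :> R.
    by rewrite lerBrDr natr1 ler_nat degree_lt.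
  have n1 : 1 < #|V|%:R :> R by rewrite ltr1n.
  have n0 : 0 < #|V|%:R :> R by rewrite ltr0n ltnW.
  have E : 1 - 1 / #|V|%:R = (#|V|%:R - 1) / #|V|%:R :> R by field; rewrite gt_eqF.
  have := le_trans H dn; rewrite E mulrA ler_pdivrMr // mulrC ler_pM2l // subr_gt0 //.
by move=> w /negbTE wu; rewrite big1 // => x _; rewrite wu mul0r.
Qed.

(** The last term makes the bound valid on all functions: it is n times the squared norm
    of the constant part of g, and lambda2 <= n.  This is the gap of the
    reduced Laplacian in dimension 0. *)
Lemma lambda2_form (g : T -> R) : (1 < #|V|)%N -> 0 < lambda2 R G ->
  lambda2 R G * \sum_(u in V) g u ^+ 2
  <= \sum_(u in V) (degree G u)%:R * g u ^+ 2
     - \sum_(u in V) \sum_(w in V | adj G u w) g u * g w + (\sum_(u in V) g u) ^+ 2.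
Proof.
move=> V1 l0; have := lambda2_form_centered g V1 l0; rewrite mulrBr lerBlDr.
move=> /le_trans; apply; rewrite lerD2l mulrCA ler_piMr ?sqr_ge0 //.
by rewrite ler_pdivrMr ?mul1r ?lambda2_le_order // ltr0n ltnW.
Qed.
End Graph.

(** * Cochains on the sets of vertices *)

(** Pairs (t, v) with v outside t correspond to pairs (s, v) with v in s through
    s = v |: t; all double countings of incident faces below go through this. *)
Lemma sum_cofaces (T : finType) (M : nmodType) (F : {set T} -> T -> M) :
  \sum_(t : {set T}) \sum_(v | v \notin t) F t v = \sum_(s : {set T}) \sum_(v in s) F (s :\ v) v.
Proof.
rewrite !pair_big_dep /=.
rewrite [RHS](reindex_onto (fun p => (p.2 |: p.1, p.2)) (fun p => (p.1 :\ p.2, p.2))) /=.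
  apply: eq_big => [[t v]|[t v] /=] /=; last by move=> /setU1K ->.
  rewrite setU11 /= xpair_eqE eqxx andbT.
  have [vt|vt] := boolP (v \in t); last by rewrite setU1K ?eqxx.
  by apply/esym/negbTE/negP => /eqP E; have := vt; rewrite -E !inE eqxx.
by move=> [s v] /= vs; rewrite setD1K.
Qed.

(** Cauchy-Schwarz against a constant; the defect is half the sum of the squares of all
    differences x i - x j. *)
Lemma sqr_sum_le (R : realDomainType) (I : finType) (P : pred I) (x : I -> R) :
  (\sum_(i | P i) x i) ^+ 2 <= #|P|%:R * \sum_(i | P i) x i ^+ 2.
Proof.
have E : \sum_(i | P i) \sum_(j | P j) (x i - x j) ^+ 2 =
   2 * (#|P|%:R * \sum_(i | P i) x i ^+ 2 - (\sum_(i | P i) x i) ^+ 2).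
  transitivity (\sum_(i | P i) (#|P|%:R * x i ^+ 2 + \sum_(j | P j) x j ^+ 2
       - 2 * x i * \sum_(j | P j) x j)).
    apply: eq_bigr => i _; rewrite mulr_natl -sumr_const mulr_sumr.
    rewrite -big_split -sumrB /=; apply: eq_bigr => j _; ring.
  rewrite sumrB big_split /= -mulr_sumr sumr_const -mulr_suml -mulr_sumr -mulr_natl.
  by ring.
rewrite -subr_ge0 -(@pmulr_rge0 _ 2) // -E.
by apply: sumr_ge0 => i _; apply: sumr_ge0 => j _; apply: sqr_ge0.
Qed.

Section Incidence.
Variables (R : realType) (T : finType).
Implicit Types (s t : {set T}) (f : {set T} -> R).

Definition face_sign s v : R := (-1) ^+ rank_in s v.
(** The incidence number [s : t], which is 0 unless t is s minus one vertex.  Cochains are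
    functions on all sets of vertices, and faces enter only through their support: this
    avoids changing types with the dimension and the complex. *)
Definition incidence s t : R := \sum_(v in s | s :\ v == t) face_sign s v.
Definition bd f t : R := \sum_s incidence s t * f s.
Definition cobd f s : R := \sum_t incidence s t * f t.
(** For fixed t this is a function of the vertex v, the localization of the cochain f at
    the face t, to which the graph Laplacian applies. *)
Definition localize f t v : R := if v \in t then 0 else face_sign (v |: t) v * f (v |: t).

Lemma face_sign_sqr s v : face_sign s v * face_sign s v = 1.
Proof. by rewrite /face_sign -expr2 sqrr_sign. Qed.

Lemma incidence_neq0 s t : incidence s t != 0 -> exists2 v, v \in s & t = s :\ v.
Proof.
move=> i0; have /exists_inP[v vs /eqP <-] : [exists v in s, s :\ v == t]; last by exists v.
apply: contraNT i0; rewrite negb_exists_in => /forall_inP n.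
by rewrite /incidence big_pred0 // => v; apply/negbTE/negP => /andP[/n/negbTE ->].
Qed.

Lemma cobdE f s : cobd f s = \sum_(v in s) face_sign s v * f (s :\ v).
Proof.
rewrite /cobd; under eq_bigr => t _ do rewrite mulr_suml big_mkcondr /=.
rewrite exchange_big /=; apply: eq_bigr => v vs.
by rewrite -big_mkcond /= (big_pred1 (s :\ v)).
Qed.

Lemma bdE f t : bd f t = \sum_v localize f t v.
Proof.
rewrite /bd; under eq_bigr => s _ do rewrite mulr_suml big_mkcond /=.
rewrite exchange_big /=; apply: eq_bigr => v _; rewrite /localize.
rewrite -big_mkcond /=; case: ifP => vt.
  rewrite big_pred0 // => s; apply/negbTE/negP => /andP[_ /eqP E].
  by move: vt; rewrite -E !inE eqxx.
rewrite (big_pred1 (v |: t)) // => s; apply/andP/eqP => [[vs /eqP <-]|->].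
  by rewrite setD1K.
by rewrite setU11 setU1K ?vt.
Qed.

(** Removing v and w from s in either order gives opposite signs; as signs are their own
    inverses, this turns the two signs of the coboundary on s into those of the
    localization at s minus v and w. *)
Lemma face_sign_mul s v w : v \in s -> w \in s -> v != w ->
  face_sign s v * face_sign s w = - (face_sign (s :\ w) v * face_sign (s :\ v) w).
Proof.
move=> vs ws vw; have E := rank_swap R vs ws vw.
rewrite -/(face_sign _ _) -/(face_sign _ _) -/(face_sign _ _) -/(face_sign _ _) in E.
have {}E : face_sign s v * (face_sign s w * face_sign (s :\ w) v) * face_sign (s :\ w) v
    = - (face_sign s v * face_sign s v) * (face_sign (s :\ v) w * face_sign (s :\ w) v).
  by rewrite E; ring.
move: E; rewrite face_sign_sqr !mulrA -mulrA face_sign_sqr mulr1 mulN1r => ->.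
by rewrite mulNr mulrC.
Qed.

Lemma setD1C s v w : s :\ v :\ w = s :\ w :\ v.
Proof. by rewrite !setDDl setUC. Qed.

(** The composite of two boundary maps is zero: the two orders of removal cancel. *)
Lemma incidence_comp s t : \sum_u incidence s u * incidence u t = 0.
Proof.
rewrite -/(cobd (incidence^~ t) s) cobdE.
pose F v w := if [&& v \in s, w \in s :\ v & s :\ v :\ w == t]
  then face_sign s v * face_sign (s :\ v) w else 0.
have -> : \sum_(v in s) face_sign s v * incidence (s :\ v) t = \sum_v \sum_w F v w.
  rewrite big_mkcond /=; apply: eq_bigr => v _; rewrite /F.
  case: (v \in s) => /=; last by rewrite big1.
  by rewrite mulr_sumr big_mkcond.
have FN v w : F v w = - F w v.
  rewrite /F !inE setD1C (eq_sym v w); case vs: (v \in s); case ws: (w \in s);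
    rewrite /= ?andbT ?andbF ?oppr0 //.
  have [_|wv] := eqVneq w v; first by rewrite oppr0.
  by case: ifP; rewrite ?oppr0 // => _; apply: rank_swap.
(* The sum of an antisymmetric function is its own opposite. *)
have E : \sum_v \sum_w F v w = - \sum_v \sum_w F v w.
  rewrite [in LHS]exchange_big /= -sumrN; apply: eq_bigr => v _.
  by rewrite -sumrN; apply: eq_bigr => w _.
by apply/eqP; rewrite -[_ == 0](mulrn_eq0 _ 2) mulr2n {1}E addNr.
Qed.

Lemma sum_localize_sqr f (h : {set T} -> T -> R) :
  \sum_t \sum_v h t v * localize f t v ^+ 2 =
  \sum_(s : {set T}) (\sum_(v in s) h (s :\ v) v) * f s ^+ 2.
Proof.
transitivity (\sum_(t : {set T}) \sum_(v | v \notin t) h t v * f (v |: t) ^+ 2).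
  apply: eq_bigr => t _; rewrite [RHS]big_mkcond /=; apply: eq_bigr => v _.
  rewrite /localize; case: (v \in t) => /=; first by rewrite expr0n mulr0.
  by rewrite exprMn [face_sign _ _ ^+ 2]expr2 face_sign_sqr mul1r.
rewrite sum_cofaces; apply: eq_bigr => s _; rewrite mulr_suml.
by apply: eq_bigr => v vs; rewrite setD1K.
Qed.

Lemma localizeD1 f s v w : w \in s -> w != v ->
  localize f (s :\ v :\ w) w = face_sign (s :\ v) w * f (s :\ v).
Proof. by move=> ws wv; rewrite /localize !inE eqxx /= setD1K // !inE wv ws. Qed.

(** Expanding the square, the diagonal terms are squares of values of f, and by
    [face_sign_mul] the term of a pair v, w is minus the product of the two values of the
    localization at s minus v and w. *)
Lemma cobd_sqr f s : cobd f s ^+ 2 = \sum_(v in s) f (s :\ v) ^+ 2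
  - \sum_(v in s) \sum_(w in s :\ v) localize f (s :\ v :\ w) v * localize f (s :\ v :\ w) w.
Proof.
rewrite cobdE expr2 mulr_suml -sumrB; apply: eq_bigr => v vs.
rewrite mulr_sumr (bigD1 v) //= mulrACA face_sign_sqr mul1r -expr2; congr (_ + _).
rewrite -sumrN; apply: eq_big => [w|w /andP[ws wv]]; first by rewrite !inE andbC.
rewrite (localizeD1 _ ws wv) setD1C localizeD1 // ?(eq_sym v) //.
rewrite mulrACA face_sign_mul // ?(eq_sym v) //; ring.
Qed.

End Incidence.

(** * The Laplacian of a flag complex *)

Section Flag.
Variables (R : realType) (T : finType) (X : scomplex T).
Implicit Types (s t : {set T}) (f : {set T} -> R).
Local Notation V := (verts X).
Local Notation G := (skeleton1 X).
Local Notation l2 := (lambda2 R G).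

Lemma flag_face s : is_flag X ->
  (forall u v, u \in s -> v \in s -> [set u; v] \in cplx_faces X) -> s \in cplx_faces X.
Proof.
case=> H XE sX; rewrite XE /= inE; apply/andP; split.
  apply/subsetP => u us; have := sX u u us us; rewrite XE /= inE => /andP[/subsetP uV _].
  by apply: uV; rewrite !inE eqxx.
apply/forall_inP => u us; apply/forall_inP => v vs; apply/implyP => uv.
have := sX u v us vs; rewrite XE /= inE => /andP[_ /forall_inP h].
have /h/forall_inP h' : u \in [set u; v] by rewrite !inE eqxx.
have /h'/implyP : v \in [set u; v] by rewrite !inE eqxx orbT.
exact.
Qed.

Lemma face_pair s u v : s \in cplx_faces X -> u \in s -> v \in s -> [set u; v] \in cplx_faces X.
Proof.
move=> sX us vs; apply: (scomplexS sX); apply/subsetP => w.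
by rewrite !inE => /orP[] /eqP ->.
Qed.

Lemma flag_setU1 s w : is_flag X -> s \in cplx_faces X ->
  (forall v, v \in w |: s -> [set v; w] \in cplx_faces X) -> w |: s \in cplx_faces X.
Proof.
move=> Xf sX wX; apply: flag_face => // x y.
case/setU1P => [->|xs] /setU1P[->|ys].
- by apply: wX; apply: setU11.
- by rewrite setUC; apply: wX; apply: setU1r.
- by apply: wX; apply: setU1r.
- exact: face_pair sX xs ys.
Qed.

(** This is where flagness is used: two cofaces of t span a face two dimensions above t
    as soon as their apices are adjacent. *)
Lemma adj_cofaces k t v w : is_flag X -> v \notin t -> w \notin t ->
  v |: t \in faces X k -> w |: t \in faces X k ->
  adj G v w = (v \notin w |: t) && (v |: (w |: t) \in faces X k.+1).
Proof.
move=> Xf vt wt; rewrite /= /skel_adj !inE => /andP[vtX /eqP ct] /andP[wtX _].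
rewrite (negbTE vt) orbF; have [//|vw] /= := eqVneq v w.
have -> : (#|v |: (w |: t)| == k.+2) = true.
  rewrite cardsU1 !inE (negbTE vw) (negbTE vt) /= cardsU1 wt.
  by move: ct; rewrite cardsU1 vt => ->; exact: eqxx.
rewrite andbT; apply/idP/idP => [vwX|vwtX]; last first.
  by apply: (face_pair vwtX); rewrite !inE eqxx ?orbT.
apply: flag_setU1 => // x; rewrite !inE => /or3P[/eqP->|/eqP->|xt].
- by apply: (face_pair vtX); apply: setU11.
- by rewrite setUC.
- by apply: (face_pair vtX); [apply: setU1r|apply: setU11].
Qed.

Definition ncofaces k s : nat := \sum_(v | v \notin s) (v |: s \in faces X k.+1).

Lemma face_verts s v : s \in cplx_faces X -> v \in s -> v \in V.
Proof. by move=> sX vs; apply/bigcupP; exists s. Qed.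

(** Count the pairs by the vertex w of X.  A vertex of s is adjacent to the k others; a
    vertex outside s is adjacent to at most k vertices of s, except if it is adjacent to
    all k + 1 of them, and then it spans a coface of s because X is flag. *)
Lemma sum_degree_le k s : is_flag X -> s \in faces X k ->
  (\sum_(v in s) degree G v <= k * #|V| + ncofaces k s)%N.
Proof.
move=> Xf sXk; have := sXk; rewrite inE => /andP[sX /eqP cs].
have -> : (\sum_(v in s) degree G v = \sum_(w in V) #|[set v in s | adj G v w]|)%N.
  transitivity (\sum_(v in s) \sum_(w in V) (adj G v w : nat))%N.
    apply: eq_bigr => v _; rewrite /degree -sum1_card big_mkcond /=.
    rewrite [RHS]big_mkcond /=; apply: eq_bigr => w _; rewrite inE.
    case vw: (skel_adj X v w); last by rewrite if_same.
    by rewrite skel_adj_sym in vw; rewrite (skel_adj_verts vw).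
  rewrite exchange_big /=; apply: eq_bigr => w _.
  rewrite -sum1_card big_mkcond [RHS]big_mkcond; apply: eq_bigr => v _; rewrite inE.
  by case: (v \in s); case: skel_adj.
have -> : (k * #|V| + ncofaces k s =
    \sum_(w in V) (k + (w \notin s) * (w |: s \in faces X k.+1)))%N.
  rewrite big_split /= sum_nat_const mulnC; congr (_ + _)%N.
  rewrite /ncofaces big_mkcond [RHS]big_mkcond /=; apply: eq_bigr => w _.
  case: (w \in s) => /=; first by rewrite mul0n if_same.
  rewrite mul1n; case: ifP => // /negbT wV; case wsX: (_ \in _) => //.
  by case/negP: wV; move: wsX; rewrite inE => /andP[/face_verts wV _]; apply/wV/setU11.
apply: leq_sum => w wV.
have [ws|ws] /= := boolP (w \in s).
  rewrite mul0n addn0 -ltnS -cs; apply: proper_card; apply/properP; split.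
    by apply/subsetP => v; rewrite inE => /andP[].
  by exists w; rewrite // inE skel_adj_irr andbF.
have adjs : [set v in s | adj G v w] \subset s by apply/subsetP => x; rewrite inE => /andP[].
rewrite mul1n; case wsX: (_ \in _); first by rewrite addn1 -cs subset_leq_card.
rewrite addn0 -ltnS -cs; apply: proper_card; apply/properP; split=> //.
have [v vs nvw] : exists2 v, v \in s & ~~ adj G v w.
  apply/exists_inP; apply: contraFT wsX; rewrite negb_exists_in => /forall_inP al.
  rewrite inE cardsU1 ws cs eqxx andbT; apply: flag_setU1 => // v /setU1P[->|vs].
    by case/bigcupP: wV => t tX wt; apply: (face_pair tX).
  by have := al v vs; rewrite negbK => /andP[].
by exists v => //; apply: contra nvw; rewrite inE => /andP[].
Qed.

Lemma localize_verts k f t v : (forall s, s \notin faces X k -> f s = 0) ->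
  v \notin V -> localize f t v = 0.
Proof.
move=> f0 vV; rewrite /localize; case: ifP => // _; rewrite f0 ?mulr0 //.
apply: contra vV; rewrite inE => /andP[/face_verts vX _]; apply/vX/setU11.
Qed.

(** Sums [cobd_sqr] over the faces and regroups the mixed terms by the codimension 2 face
    t.  A pair v, w contributes exactly when v, w and t span a face; by [adj_cofaces] this
    means that v and w are adjacent in the graph, so that the mixed terms are the
    off-diagonal part of the graph Laplacian on the localizations of f. *)
Lemma sum_cobd_sqr k f : is_flag X -> (forall s, s \notin faces X k -> f s = 0) ->
  \sum_(s in faces X k.+1) cobd f s ^+ 2 = \sum_s (ncofaces k s)%:R * f s ^+ 2
   - \sum_t \sum_v \sum_(w | adj G v w) localize f t v * localize f t w.
Proof.
move=> Xf f0; under eq_bigr do rewrite cobd_sqr.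
rewrite sumrB; congr (_ - _).
  transitivity (\sum_(s : {set T}) \sum_(v in s)
      (v |: (s :\ v) \in faces X k.+1)%:R * f (s :\ v) ^+ 2).
    rewrite big_mkcond; apply: eq_bigr => s _; case: ifPn => sX.
      by apply: eq_bigr => v vs; rewrite setD1K // sX mul1r.
    by rewrite big1 // => v vs; rewrite setD1K // (negbTE sX) mul0r.
  rewrite -(sum_cofaces (fun s v => (v |: s \in faces X k.+1)%:R * f s ^+ 2)).
  by apply: eq_bigr => s _; rewrite -mulr_suml natr_sum.
pose F t v w := localize f t v * localize f t w.
transitivity (\sum_(s : {set T}) \sum_(v in s) (if v |: (s :\ v) \in faces X k.+1 then
    \sum_(w in s :\ v) F (s :\ v :\ w) v w else 0)).
  rewrite big_mkcond; apply: eq_bigr => s _; case: ifPn => sX.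
    by apply: eq_bigr => v vs; rewrite setD1K // sX.
  by rewrite big1 // => v vs; rewrite setD1K // (negbTE sX).
rewrite -(sum_cofaces (fun s v => if v |: s \in faces X k.+1 then
   \sum_(w in s) F (s :\ w) v w else 0)).
(* The condition on v is moved inside the sum over w, where it depends on the pair
   (s :\ w, w) only, so that [sum_cofaces] applies a second time. *)
transitivity (\sum_v \sum_(s : {set T}) \sum_(w in s)
   (if (v \notin w |: (s :\ w)) && (v |: (w |: (s :\ w)) \in faces X k.+1)
    then F (s :\ w) v w else 0)).
  rewrite (exchange_big_dep xpredT) //=; apply: eq_bigr => v _.
  rewrite big_mkcond; apply: eq_bigr => s _.
  case: ifPn => vs; last first.
    by rewrite big1 // => w ws; rewrite setD1K // (negbTE vs).
  case: ifPn => vsX.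
    by apply: eq_bigr => w ws; rewrite setD1K // vs vsX.
  by rewrite big1 // => w ws; rewrite setD1K // (negbTE vsX) andbF.
rewrite [RHS]exchange_big; apply: eq_bigr => v _ /=.
rewrite -(sum_cofaces (fun s w => if (v \notin w |: s) && (v |: (w |: s) \in faces X k.+1)
   then F s v w else 0)).
apply: eq_bigr => t _; rewrite big_mkcond [RHS]big_mkcond; apply: eq_bigr => w _.
rewrite /F /localize /=; have [wt|wt] /= := boolP (w \in t); first by rewrite mulr0 if_same.
have [vt|vt] := boolP (v \in t); first by rewrite mul0r !if_same.
have [vtX|vtX] := boolP (v |: t \in faces X k); last by rewrite (f0 _ vtX) mulr0 mul0r !if_same.
have [wtX|wtX] := boolP (w |: t \in faces X k); last by rewrite (f0 _ wtX) !mulr0 !if_same.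
by rewrite -(adj_cofaces Xf vt wt vtX wtX).
Qed.

(** The eigenvalue estimate of Aharoni, Berger and Meshulam: the combinatorial Laplacian in
    dimension k is at least (k + 1) * lambda2 - k * n.  Apply [lambda2_form] to the
    localization of f at each t, and sum over t.  The squared norms add up to (k + 1) times
    that of f, since a k-face has k + 1 facets; the squared sums add up to the squared norm
    of the boundary of f; and the Laplacian terms give the squared norm of the coboundary,
    up to a diagonal term bounded by [sum_degree_le]. *)
Lemma flag_hodge_form k f : is_flag X -> (1 < #|V|)%N -> 0 < l2 ->
  (forall s, s \notin faces X k -> f s = 0) ->
  k.+1%:R * l2 * \sum_s f s ^+ 2 <=
  (k * #|V|)%:R * \sum_s f s ^+ 2 + \sum_(s in faces X k.+1) cobd f s ^+ 2
    + \sum_t bd f t ^+ 2.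
Proof.
move=> Xf V1 l0 f0.
have gap t := @lambda2_form R T G (localize f t) V1 l0.
have offV (F : T -> R) : (forall v, v \notin V -> F v = 0) -> \sum_(v in V) F v = \sum_v F v.
  by move=> F0; rewrite [RHS](bigID (mem V)) /= [X in _ + X]big1 ?addr0.
have card_sum : \sum_t \sum_(v in V) localize f t v ^+ 2 = k.+1%:R * \sum_s f s ^+ 2.
  transitivity (\sum_t \sum_v (fun _ _ => 1) t v * localize f t v ^+ 2).
    apply: eq_bigr => t _; rewrite offV => [|v vV]; last by rewrite (localize_verts _ f0) ?expr0n.
    by apply: eq_bigr => v _; rewrite mul1r.
  rewrite sum_localize_sqr mulr_sumr; apply: eq_bigr => s _; rewrite sumr_const.
  have [|/f0 ->] := boolP (s \in faces X k); last by rewrite expr0n !mulr0.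
  by rewrite inE => /andP[_ /eqP ->].
have deg_sum : \sum_t \sum_(v in V) (degree G v)%:R * localize f t v ^+ 2 <=
    (k * #|V|)%:R * \sum_s f s ^+ 2 + \sum_s (ncofaces k s)%:R * f s ^+ 2.
  rewrite (eq_bigr (fun t => \sum_v (degree G v)%:R * localize f t v ^+ 2)); last first.
    by move=> t _; rewrite offV // => v vV; rewrite (localize_verts _ f0) ?expr0n ?mulr0.
  rewrite (sum_localize_sqr f (fun _ v => (degree G v)%:R)) mulr_sumr -big_split /=.
  apply: ler_sum => s _; rewrite -mulrDl -natr_sum -natrD.
  have [sX|/f0 ->] := boolP (s \in faces X k); last by rewrite expr0n !mulr0.
  by rewrite ler_wpM2r ?sqr_ge0 // ler_nat sum_degree_le.
have adj_sum : \sum_t \sum_(v in V) \sum_(w in V | adj G v w) localize f t v * localize f t w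
    = \sum_t \sum_v \sum_(w | adj G v w) localize f t v * localize f t w.
  apply: eq_bigr => t _; rewrite -[RHS]offV => [|v vV]; last first.
    by rewrite big1 // => w _; rewrite (localize_verts _ f0 vV) mul0r.
  apply: eq_bigr => v _; apply: eq_bigl => w.
  have [vw|_] := boolP (adj G v w); last by rewrite andbF.
  by rewrite adj_sym in vw; rewrite (adj_verts vw).
have bd_sum : \sum_t (\sum_(v in V) localize f t v) ^+ 2 = \sum_t bd f t ^+ 2.
  apply: eq_bigr => t _; rewrite bdE offV // => v vV; exact: localize_verts f0 vV.
have := ler_sum (index_enum _) (fun t (_ : true) => gap t).
rewrite -mulr_sumr card_sum big_split sumrB /= adj_sum bd_sum (sum_cobd_sqr Xf f0).
set S := \sum_t \sum_v _; set D := \sum_t _ in deg_sum *.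
move: deg_sum; lra.
Qed.

End Flag.

(** * Exactness from the absence of harmonic vectors *)

Lemma row_dot_ge0 (R : realDomainType) n (u : 'rV[R]_n) : 0 <= (u *m u^T) 0 0.
Proof. by rewrite mxE sumr_ge0 // => i _; rewrite mxE -expr2 sqr_ge0. Qed.

Lemma row_dot_eq0 (R : realDomainType) n (u : 'rV[R]_n) : (u *m u^T) 0 0 = 0 -> u = 0.
Proof.
rewrite mxE => /eqP; rewrite psumr_eq0 => [/allP u0|i _]; last by rewrite mxE -expr2 sqr_ge0.
apply/rowP => i; have := u0 i (mem_index_enum _).
by rewrite !mxE -expr2 sqrf_eq0 => /eqP.
Qed.

(** Finite-dimensional Hodge theory.  The Laplacian M is symmetric with trivial kernel,
    hence invertible; writing a cycle z as y M splits it into a boundary and a vector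
    w = y Q Q^T, and z Q = 0 forces w Q = 0, so that w is orthogonal to itself. *)
Lemma exact_of_no_harmonic_mx (R : realFieldType) m n p (P : 'M[R]_(m, n)) (Q : 'M[R]_(n, p)) :
  P *m Q = 0 -> (forall z : 'rV_n, z *m P^T = 0 -> z *m Q = 0 -> z = 0) ->
  forall z : 'rV_n, z *m Q = 0 -> (z <= P)%MS.
Proof.
move=> PQ H z zQ; pose M := P^T *m P + Q *m Q^T.
have Mu : M \in unitmx.
  rewrite -row_free_unit -kermx_eq0; apply/eqP/row_matrixP => i; rewrite row0.
  set u := row i _; have uM : u *m M = 0 by apply/sub_kermxP; apply: row_sub.
  have : ((u *m P^T) *m (u *m P^T)^T) 0 0 + ((u *m Q) *m (u *m Q)^T) 0 0 = 0.
    have : (u *m M *m u^T) 0 0 = 0 by rewrite uM mul0mx mxE.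
    by rewrite /M mulmxDr mulmxDl mxE !trmx_mul !trmxK !mulmxA.
  move/eqP; rewrite paddr_eq0 ?row_dot_ge0 // => /andP[/eqP/row_dot_eq0 h1 /eqP/row_dot_eq0 h2].
  exact: H.
pose y := z *m invmx M.
have zE : z = y *m P^T *m P + y *m Q *m Q^T.
  by rewrite -[LHS](mulmxKV Mu) /M mulmxDr !mulmxA.
have /row_dot_eq0 w0 : ((y *m Q *m Q^T) *m (y *m Q *m Q^T)^T) 0 0 = 0.
  have : y *m Q *m Q^T *m Q = 0.
    by move: zQ; rewrite {1}zE mulmxDl -(mulmxA _ P) PQ mulmx0 add0r.
  by move=> E; rewrite trmx_mul trmxK mulmxA E mul0mx mxE.
by rewrite zE w0 addr0 submxMl.
Qed.

(** The same with functions on finite types for vectors, those on I having support in S. *)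
Lemma exact_of_no_harmonic (R : realFieldType) (I J K : finType) (S : {set I})
    (P : J -> I -> R) (Q : I -> K -> R) :
  (forall j k, \sum_(i in S) P j i * Q i k = 0) ->
  (forall z : I -> R, (forall i, i \notin S -> z i = 0) ->
    (forall j, \sum_(i in S) P j i * z i = 0) ->
    (forall k, \sum_(i in S) Q i k * z i = 0) -> forall i, i \in S -> z i = 0) ->
  forall z : I -> R, (forall k, \sum_(i in S) Q i k * z i = 0) ->
    exists y : J -> R, forall i, i \in S -> z i = \sum_j P j i * y j.
Proof.
move=> PQ H z zQ.
pose Pm : 'M[R]_(#|J|, #|S|) := \matrix_(j, i) P (enum_val j) (enum_val i).
pose Qm : 'M[R]_(#|S|, #|K|) := \matrix_(i, k) Q (enum_val i) (enum_val k).
pose zm : 'rV[R]_#|S| := \row_i z (enum_val i).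
have /submxP[y yE] : (zm <= Pm)%MS.
  apply: (@exact_of_no_harmonic_mx _ _ _ _ _ Qm).
  - apply/matrixP => j k; rewrite !mxE -[RHS](PQ (enum_val j) (enum_val k)) [RHS]big_enum_val.
    by apply: eq_bigr => i _; rewrite !mxE.
  - move=> u uP uQ; pose f i := \sum_(a < #|S| | enum_val a == i) u 0 a.
    have fE a : f (enum_val a) = u 0 a.
      by rewrite /f (big_pred1 a) // => b; rewrite /= (inj_eq enum_val_inj).
    apply/rowP => a; rewrite -fE mxE; apply: H; last exact: enum_valP.
    + move=> i iS; rewrite /f big_pred0 // => b; apply/negbTE/negP => /eqP bi.
      by move: iS; rewrite -bi enum_valP.
    + move=> j; move/rowP/(_ (enum_rank j)): uP; rewrite !mxE => E; rewrite -[RHS]E {E}.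
      rewrite [LHS]big_enum_val; apply: eq_bigr => i _; rewrite !mxE fE enum_rankK.
      exact: mulrC.
    + move=> k; move/rowP/(_ (enum_rank k)): uQ; rewrite !mxE => E; rewrite -[RHS]E {E}.
      rewrite [LHS]big_enum_val; apply: eq_bigr => i _; rewrite !mxE fE enum_rankK.
      exact: mulrC.
  - apply/rowP => k; rewrite !mxE -[RHS](zQ (enum_val k)) [RHS]big_enum_val.
    by apply: eq_bigr => i _; rewrite !mxE mulrC.
exists (fun j => y 0 (enum_rank j)) => i iS.
have := congr1 (fun B : 'rV__ => B 0 (enum_rank_in iS i)) yE.
rewrite !mxE enum_rankK_in // => ->.
rewrite [RHS](reindex_onto enum_val enum_rank) /=; last by move=> j _; rewrite enum_rankK.
apply: eq_big => [a|a _]; first by rewrite enum_valK eqxx.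
by rewrite !mxE enum_valK enum_rankK_in // mulrC.
Qed.

(** * Relative cochains *)

Lemma incidence_sqr_le1 (R : realType) (T : finType) (s t : {set T}) : incidence R s t ^+ 2 <= 1.
Proof.
have [->|/incidence_neq0[v vs ->]] := eqVneq (incidence R s t) 0; first by rewrite expr0n ler01.
rewrite /incidence (big_pred1 v) ?expr2 ?face_sign_sqr // => w /=.
apply/andP/eqP => [[ws /eqP E]|->] //.
apply/eqP; have := setD11 v s; rewrite -E !inE vs andbT.
by move/negbFE; rewrite eq_sym.
Qed.

Section Relative.
Variables (R : realType) (T : finType) (X A : scomplex T) (k : nat).
Local Notation S := (faces X k :\: faces A k).
Local Notation D := (faces X k.-1 :\: faces A k.-1).
Implicit Types (s t : {set T}) (f : {set T} -> R).

(** Count by x: for x = s one gets the facets of s in A, and for x different from s the only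
    possible t is x :&: s. *)
Lemma card_flags_le s : (0 < k)%N -> s \in S ->
  (\sum_(t in faces A k.-1 | t \subset s) #|[set x in S | t \subset x]| <=
   #|subfaces X s k.-1 :&: faces A k.-1| + #|[set t in S | t :&: s \in faces A k.-1]|)%N.
Proof.
move=> k_gt0 sS; have cS x : x \in S -> #|x| = k.+1 by rewrite !inE => /andP[_ /andP[_ /eqP]].
have inter x t : x \in S -> x != s -> t \in faces A k.-1 -> t \subset s -> t \subset x ->
    t = x :&: s.
  move=> xS xs; rewrite inE => /andP[_ /eqP ct] ts tx; apply/eqP.
  rewrite eqEcard subsetI tx ts /= ct prednK // -ltnS -(cS x xS); apply: proper_card.
  rewrite properE subsetIl subsetI subxx /=; apply: contra xs => xsub.
  by rewrite eqEcard xsub (cS x xS) (cS s sS) /= leqnn.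
under eq_bigr do rewrite -sum1dep_card.
rewrite (exchange_big_dep (mem S)) /=; last by move=> t x _ /andP[].
rewrite -[X in (_ <= _ + X)%N]sum1dep_card [X in (_ <= _ + X)%N]big_mkcondr /=.
apply: (@leq_trans (\sum_(x in S) ((x == s) * #|subfaces X s k.-1 :&: faces A k.-1|
    + (x :&: s \in faces A k.-1)))).
  apply: leq_sum => x xS.
  rewrite sum1dep_card; have [->|xs] := eqVneq x s.
    rewrite mul1n; apply: leq_trans (leq_addr _ _); apply/subset_leq_card/subsetP => t.
    rewrite !inE => /and3P[/andP[/andP[tA ct] ts] _ _]; rewrite ts tA ct !andbT.
    by apply: (scomplexS (s := s)) => //; move: sS; rewrite !inE => /and3P[].
  rewrite mul0n add0n; have [xsA|xsA] := boolP (x :&: s \in faces A k.-1).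
    apply: (@leq_trans #|[set x :&: s]|); last by rewrite cards1.
    apply/subset_leq_card/subsetP => t.
    rewrite in_set in_set1 => /andP[/andP[tA ts] /andP[_ tx]].
    by apply/eqP; apply: inter.
  rewrite leqn0 cards_eq0; apply/eqP/setP => t; rewrite [RHS]inE; apply/negbTE/negP.
  rewrite in_set => /andP[/andP[tA ts] /andP[_ tx]].
  by move: xsA; rewrite -(inter x t) // tA.
rewrite big_split /= (bigD1 s) //= eqxx mul1n big1 ?addn0 => [|x /andP[_ /negbTE ->] //].
by rewrite leq_add2l; apply: leq_sum => x _; case: (_ \in _).
Qed.

(** At a face t of A, [sqr_sum_le] bounds the squared boundary by the number of relative
    k-faces above t times the sum of their squared values; [card_flags_le] then bounds the
    resulting coefficient of each f s ^+ 2. *)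
Lemma sum_bd_sqr_le f : (0 < k)%N -> (forall s, s \notin S -> f s = 0) ->
  \sum_(t in faces A k.-1) bd f t ^+ 2 <=
  (\max_(s in S) (#|subfaces X s k.-1 :&: faces A k.-1|
     + #|[set t in S | t :&: s \in faces A k.-1]|))%:R
   * \sum_s f s ^+ 2.
Proof.
move=> k_gt0 f0; set M := \max_(s in S) _.
pose N t := #|[set x in S | t \subset x]|.
apply: (@le_trans _ _ (\sum_(t in faces A k.-1) \sum_(s in S | t \subset s) (N t)%:R * f s ^+ 2)).
  apply: ler_sum => t _; rewrite -mulr_sumr.
  have -> : bd f t = \sum_(s in S | t \subset s) incidence R s t * f s.
    rewrite /bd [RHS]big_mkcond; apply: eq_bigr => s _; case: ifPn => //.
    rewrite negb_and => /orP[/f0 ->|ts]; first by rewrite mulr0.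
    have [->|/incidence_neq0[v _ E]] := eqVneq (incidence R s t) 0; first by rewrite mul0r.
    by rewrite E subsetDl in ts.
  apply: le_trans (sqr_sum_le _ _) _; rewrite /N cardsE ler_wpM2l ?ler0n //.
  by apply: ler_sum => s _; rewrite exprMn ler_piMl ?sqr_ge0 ?incidence_sqr_le1.
rewrite (exchange_big_dep (mem S)) /=; last by move=> t s _ /andP[].
rewrite (bigID (mem S) predT) /= mulrDr.
rewrite -[leLHS]addr0 lerD //; last first.
  by rewrite mulr_ge0 ?ler0n // sumr_ge0 // => s _; apply: sqr_ge0.
rewrite mulr_sumr; apply: ler_sum => s sS; rewrite -mulr_suml ler_wpM2r ?sqr_ge0 //.
rewrite -natr_sum ler_nat; apply: leq_trans (leq_bigmax_cond _ sS).
apply: leq_trans (card_flags_le k_gt0 sS); rewrite leq_eqVlt; apply/orP; left; apply/eqP.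
by apply: eq_bigl => t; rewrite sS.
Qed.

(** For the Laplacian of the pair (X, A) the boundary at the faces of A is dropped, which costs
    at most the bound of [sum_bd_sqr_le]; beyond it the estimate for X leaves a positive
    definite form. *)
Lemma relative_harmonic_eq0 f : is_flag X -> (1 < #|verts X|)%N ->
  0 < lambda2 R (skeleton1 X) -> (0 < k)%N ->
  (k * #|verts X| + \max_(s in S) (#|subfaces X s k.-1 :&: faces A k.-1|
     + #|[set t in S | t :&: s \in faces A k.-1]|))%:R < k.+1%:R * lambda2 R (skeleton1 X) ->
  (forall s, s \notin S -> f s = 0) ->
  (forall r, r \in faces X k.+1 -> cobd f r = 0) ->
  (forall t, t \in D -> bd f t = 0) -> forall s, f s = 0.
Proof.
set M := \max_(s in S) _ => X_flag V_gt1 l2_gt0 k_gt0 gap f0 cf bf.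
have fX s : s \notin faces X k -> f s = 0.
  by move=> sX; apply: f0; rewrite inE (negbTE sX) andbF.
have := flag_hodge_form X_flag V_gt1 l2_gt0 fX.
rewrite [X in _ + X + _]big1 ?addr0 => [|r rX]; last by rewrite cf ?expr0n.
have -> : \sum_t bd f t ^+ 2 = \sum_(t in faces A k.-1) bd f t ^+ 2.
  rewrite (bigID (mem (faces A k.-1)) predT) /= [X in _ + X]big1 ?addr0 // => t tA.
  have [tX|tX] := boolP (t \in faces X k.-1); first by rewrite bf ?expr0n // in_setD tA.
  rewrite /bd big1 ?expr0n // => s _.
  have [sX|/fX ->] := boolP (s \in faces X k); last by rewrite mulr0.
  have [->|/incidence_neq0[v vs tE]] := eqVneq (incidence R s t) 0; first by rewrite mul0r.
  case/negP: tX; rewrite inE tE; move: sX; rewrite inE => /andP[sX /eqP cs].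
  rewrite (scomplexS sX) ?subsetDl //= prednK //.
  by have := cardsD1 v s; rewrite vs cs add1n => -[<-].
have := sum_bd_sqr_le k_gt0 f0; rewrite -/M.
set F := \sum_s _; set B := \sum_(t in _) _ => bF main.
have F_ge0 : 0 <= F by apply: sumr_ge0 => s _; apply: sqr_ge0.
have F0 : F = 0.
  apply/eqP; rewrite eq_le F_ge0 andbT leNgt; apply/negP => F_gt0.
  have := le_trans main (lerD (lexx _) bF).
  by rewrite -mulrDl ler_pM2r // -natrD leNgt gap.
move=> s; have /eqP := F0; rewrite psumr_eq0 => [/allP F_all|x _]; last exact: sqr_ge0.
by have := F_all s (mem_index_enum _); rewrite sqrf_eq0 => /eqP.
Qed.

(** The sum may be extended to all s: a face s with both incidence numbers nonzero lies
    between r and t, so it is a face of X, and not of A since t is not. *)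
Lemma relative_incidence_comp r t : r \in faces X k.+1 -> t \in D ->
  \sum_(s in S) incidence R r s * incidence R s t = 0.
Proof.
move=> rX tD; rewrite -[RHS](incidence_comp R r t) [RHS](bigID (mem S)) /=.
rewrite [X in _ = _ + X]big1 ?addr0 // => s sS.
have [->|/incidence_neq0[v vr sE]] := eqVneq (incidence R r s) 0; first by rewrite mul0r.
have [->|/incidence_neq0[w ws tE]] := eqVneq (incidence R s t) 0; first by rewrite mulr0.
move: sS; rewrite in_setD negb_and negbK => /orP[sA|/negP[]].
  move: tD; rewrite in_setD => /andP[/negP tA tX]; case: tA; move: sA tX.
  by rewrite !inE => /andP[sA _] /andP[_ ct]; rewrite ct tE (scomplexS sA) ?subsetDl.
move: rX; rewrite inE => /andP[rX /eqP cr].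
rewrite sE inE (scomplexS rX) ?subsetDl //=.
by have := cardsD1 v r; rewrite vr cr add1n => -[<-].
Qed.

End Relative.

(** * Simplicial chains as cochains *)

Section Coefficients.
Variables (R : realType) (T : finType) (X : scomplex T) (k : nat).

Definition chain_coef (c : chain R X k) (s : {set T}) : R :=
  if insub s is Some x then c x else 0.

Lemma chain_coefE (c : chain R X k) (x : simplex X k) : chain_coef c (val x) = c x.
Proof. by rewrite /chain_coef valK. Qed.

Lemma boundary_bd (c : chain R X k) t : boundary_fun c t = bd (chain_coef c) (val t).
Proof.
rewrite ffunE /bd (bigID (mem (faces X k))) /= [X in _ = _ + X]big1 ?addr0; last first.
  by move=> s sX; rewrite /chain_coef insubN ?mulr0.
rewrite (reindex_omap val (insub : _ -> option (simplex X k))) /=; last first.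
  by move=> s sX; rewrite insubT.
apply: eq_big => [x|x _]; first by rewrite valK eqxx (valP x).
by rewrite chain_coefE mulr_suml.
Qed.

End Coefficients.

(** * The vanishing theorem *)

Theorem corollary1p12 (R : realType) (T : finType) (X A : scomplex T) (n k : nat)
    (X_flag : is_flag X)
    (A_sub_X : cplx_faces A \subset cplx_faces X)
    (card_X : #|verts X| = n)
    (k_ge1 : (1 <= k)%N)
    (XA_neq0 : faces X k :\: faces A k != set0)
    (gap : lambda2 R (skeleton1 X) >
       (k.+1%:R)^-1 *
       (k * n + \max_(s in faces X k :\: faces A k)
          (#|subfaces X s k.-1 :&: faces A k.-1|
           + #|[set t in faces X k :\: faces A k | t :&: s \in faces A k.-1]|))%N%:R) :
  forall h : rel_homology R X A k, h = 0.
Proof.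
have k1_gt0 : 0 < k.+1%:R :> R by rewrite ltr0n.
have l2_gt0 : 0 < lambda2 R (skeleton1 X).
  by apply: le_lt_trans gap; rewrite mulr_ge0 ?invr_ge0 ?ler0n.
have V_gt1 : (1 < #|verts X|)%N.
  have /set0Pn[s] := XA_neq0; rewrite !inE => /andP[_ /andP[sX /eqP cs]].
  apply: (@leq_trans #|s|); first by rewrite cs.
  by apply/subset_leq_card/subsetP => v; apply: face_verts.
pose S := faces X k :\: faces A k; pose D := faces X k.-1 :\: faces A k.-1.
pose P r s : R := if r \in faces X k.+1 then incidence R r s else 0.
pose Q s t : R := if t \in D then incidence R s t else 0.
have overS (f g : {set T} -> R) : (forall s, s \notin S -> f s = 0) ->
    \sum_(s in S) g s * f s = \sum_s g s * f s.
  move=> f0; rewrite [RHS](bigID (mem S)) /= [X in _ + X]big1 ?addr0 // => s sS.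
  by rewrite f0 ?mulr0.
have PQ r t : \sum_(s in S) P r s * Q s t = 0.
  have [rX|/negbTE rX] := boolP (r \in faces X k.+1); last first.
    by rewrite big1 // => s _; rewrite /P rX mul0r.
  have [tD|/negbTE tD] := boolP (t \in D); last first.
    by rewrite big1 // => s _; rewrite /Q tD mulr0.
  by under eq_bigr do rewrite /P rX /Q tD; apply: relative_incidence_comp.
apply: (rel_homology_eq0P R X A k).2 => c dc.
(* The relative chain of c is represented by its part outside A. *)
pose z s := if s \in S then chain_coef c s else 0.
have z0 s : s \notin S -> z s = 0 by rewrite /z => /negbTE ->.
have [y yE] : exists y : {set T} -> R, forall s, s \in S -> z s = \sum_r P r s * y r.
  apply: (exact_of_no_harmonic PQ) => [f f0 Pf Qf s _|t].
    apply: (@relative_harmonic_eq0 R T X A k) => // [|r rX|t tD].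
    - by move: gap; rewrite mulrC ltr_pdivrMr // mulrC card_X.
    - by have := Pf r; rewrite overS // /P rX.
    - by have := Qf t; rewrite overS // /Q tD.
  have [tD|/negbTE tD] := boolP (t \in D); last first.
    by rewrite big1 // => s _; rewrite /Q tD mul0r.
  rewrite overS //; under eq_bigr do rewrite /Q tD.
  move: tD; rewrite in_setD => /andP[tA tX].
  have /subchainP/(_ (Sub t tX) tA) := dc; rewrite boundary_bd /= => bd0.
  (* Faces of A do not contribute to the boundary at t, which is not in A. *)
  rewrite -[RHS]bd0; apply: eq_bigr => s _; rewrite /z; case: ifPn => // sS.
  have [->|/incidence_neq0[v vs tE]] := eqVneq (incidence R s t) 0; first by rewrite !mul0r.
  rewrite /chain_coef; case: insubP => [x sX xE|_ //].
  move: sS; rewrite in_setD sX andbT negbK inE => /andP[sA _].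
  by move: tA tX; rewrite !inE => + /andP[_ ct]; rewrite ct tE (scomplexS sA) ?subsetDl.
exists [ffun r : simplex X k.+1 => y (val r)].
apply/subchainP => s sA; have sS : val s \in S by rewrite in_setD sA (valP s).
rewrite [LHS]ffunE [X in _ + X = _]ffunE -chain_coefE; apply/eqP; rewrite subr_eq0; apply/eqP.
have := yE _ sS; rewrite /z sS => ->; rewrite boundary_bd /bd.
apply: eq_bigr => r _; rewrite /P; case: ifPn => rX.
  by rewrite -[r in chain_coef _ r](SubK (simplex X k.+1) rX) chain_coefE ffunE SubK.
by rewrite mul0r /chain_coef insubN ?mulr0.
Qed.
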